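(* Let $n\ge 2$ and $m\ge 0$ be integers, let $i$ be an even integer and $j$ an integer. Then the alcove $(i,j)$ is in the shadow of the alcove $(n,m)$, i.e. $a(i,j)\in \mathrm{Sh}(a(n,m))$, if and only if $$2-k\bigl(n,m,\tfrac{i+2j}{2}\bigr)\le i\le k\bigl(n,m,\tfrac{i+2j}{2}\bigr).$$ Moreover, there is an algorithm which, given any two reduced words $x,y$ in the generators $s_0,s_1,s_2$, determines whether $x\le y$ in the Bruhat order of $W$ in $O(\ell(y))$ time.
   Context: $W=\langle s_0,s_1,s_2\mid s_i^2=1,(s_0s_1)^3=(s_0s_2)^3=(s_1s_2)^3=1\rangle$ is the Coxeter group of type $\tilde A_2$, with length function $\ell$. Subscripts of generators are read modulo 3. For $k\ge 0$, $\gamma_i(k)=s_is_{i+1}s_{i+2}\cdots$ ($k$ letters, subscripts increasing by one mod 3) and $\delta_i(k)=s_is_{i-1}s_{i-2}\cdots$ ($k$ letters, subscripts decreasing by one mod 3). Put $\epsilon_k=1$ if $k$ is odd and $\epsilon_k=0$ if $k$ is even. Coordinates: elements of $W$ correspond bijectively to alcoves. For $(n,m)\in\mathbb Z^2$ the alcove $(n,m)$ is the element $a(n,m)=b(n)\,c(n,m)\in W$, where $b(n)=\gamma_0(n)$ if $n\ge 0$, $b(n)=\delta_2(-n)$ if $n<0$, and $c(n,m)=\delta_{n+1}(m)$ if $m\ge 0$, $c(n,m)=\gamma_{n+2}(-m)$ if $m<0$. Both parities of $n$ are allowed; each element has exactly one pair of coordinates with $n$ even and exactly one with $n$ odd. Shadow: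 for $w\in W$ with reduced word $s_{i_1}\cdots s_{i_r}$, $\mathrm{Sh}(w)$ is the set of end alcoves $c_r$ of all (possibly folded) galleries $c_0=1,c_1,\dots,c_r$ with $c_t\in\{c_{t-1},c_{t-1}s_{i_t}\}$ for each $t$. It does not depend on the reduced word and equals the Bruhat interval $[1,w]$. The function $k$: for integers $n\ge 2$, $m\ge 0$ and $c$: - if $m=0$ and $4-2n\le 2c\le n-\epsilon_n$, then $k(n,m,c)=2\left\lfloor\frac{n+c+1+\epsilon_n}{3}\right\rfloor$; - if $m\ne 0$ and $4-2n-m+\epsilon_m\le 2c\le n-m-2\epsilon_n+3\epsilon_m-\epsilon_n\epsilon_m$, then $k(n,m,c)=2\left\lfloor\frac{2n+4m+2c-2+6\epsilon_n}{6}\right\rfloor$; - if $m\neq 0$ and $n-m+2-3\epsilon_n+3\epsilon_m\le 2c\le n+2m-3\epsilon_n$, then $k(n,m,c)=2\left\lfloor\frac{4n+2m-2c+2-2\epsilon_m}{6}\right\rfloor$; - otherwise $k(n,m,c)=0$. Running time counts elementary operations, with integer arithmetic operations, comparisons and floor operations at unit cost; $\ell(y)$ is the number of letters of the reduced word $y$. *)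

(* Defs.v *)
From HB Require Import structures.
From Stdlib Require Import Relations.
From mathcomp Require Import all_boot all_order all_algebra.
From mathcomp Require Import boolp.

Set Implicit Arguments.
Unset Strict Implicit.
Unset Printing Implicit Defensive.

Import Order.TTheory GRing.Theory Num.Theory.
Local Open Scope quotient_scope.
Local Open Scope group_scope.

(** * The Coxeter group of type A2~ *)

(* Subscripts of generators live in 'Z_3, where arithmetic is modulo 3. *)
Definition word := seq 'Z_3.

(* Equality of words in the presented group. As every generator is its own
   inverse, words in the generators suffice: no formal inverses are needed. *)
Inductive weq : word -> word -> Prop :=
| weq_refl u : weq u u
| weq_sym u v : weq u v -> weq v u
| weq_trans u v w : weq u v -> weq v w -> weq u w
| weq_cat u u' v v' : weq u u' -> weq v v' -> weq (u ++ v) (u' ++ v')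
| weq_invol (i : 'Z_3) : weq [:: i; i] [::]
| weq_braid (i j : 'Z_3) : (i < j)%N -> weq [:: i; j; i; j; i; j] [::].

Definition weqb : rel word := fun u v => `[< weq u v >].

Lemma weqb_equiv : equiv_class_of weqb.
Proof.
split=> [u|u v|v u w].
- exact/asboolP/weq_refl.
- by apply/asboolP/asboolP; apply: weq_sym.
- by move=> /asboolP uv /asboolP vw; apply/asboolP; apply: weq_trans uv vw.
Qed.

Definition weq_rel : equiv_rel word := EquivRelPack weqb_equiv.

Definition W := {eq_quot weq_rel}.
HB.instance Definition _ := Choice.on W.
HB.instance Definition _ := EqQuotient.on W.

Definition Wof (u : word) : W := \pi_W u.

Lemma WofP (u v : word) : Wof u = Wof v <-> weq u v.
Proof.
split=> [/eqmodP /asboolP //|uv].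
exact/eqmodP/asboolP.
Qed.

Lemma Wof_repr (x : W) : Wof (repr x) = x.
Proof. exact: reprK. Qed.

Lemma weq_repr (u : word) : weq (repr (Wof u)) u.
Proof. by apply/WofP; rewrite Wof_repr. Qed.

Definition Wone : W := Wof [::].
Definition Winv (x : W) : W := Wof (rev (repr x)).
Definition Wmul (x y : W) : W := Wof (repr x ++ repr y).

Lemma WmulE u v : Wmul (Wof u) (Wof v) = Wof (u ++ v).
Proof. by apply/WofP; apply: weq_cat; apply: weq_repr. Qed.

Lemma weq_rev_cat u : weq (rev u ++ u) [::].
Proof.
elim: u => [|i u IHu]; first exact: weq_refl.
rewrite rev_cons cat_rcons.
apply: weq_trans IHu; apply: weq_cat; first exact: weq_refl.
rewrite -[_ :: _]/([:: i; i] ++ u) -[u in weq _ u]cat0s.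
by apply: weq_cat; [exact: weq_invol | exact: weq_refl].
Qed.

Fact WmulA : associative Wmul.
Proof.
by move=> x y z; rewrite -(Wof_repr x) -(Wof_repr y) -(Wof_repr z) !WmulE catA.
Qed.

Fact Wmul1 : left_id Wone Wmul.
Proof. by move=> x; rewrite -(Wof_repr x) WmulE. Qed.

Fact W1mul : right_id Wone Wmul.
Proof. by move=> x; rewrite -(Wof_repr x) WmulE cats0. Qed.

Fact WmulV : left_inverse Wone Winv Wmul.
Proof.
move=> x; rewrite -[x in Wmul _ x]Wof_repr WmulE.
exact/WofP/weq_rev_cat.
Qed.

Fact WVmul : right_inverse Wone Winv Wmul.
Proof.
move=> x; rewrite -[x in Wmul x]Wof_repr WmulE -{1}[repr x]revK.
exact/WofP/weq_rev_cat.
Qed.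

HB.instance Definition _ := isGroup.Build W WmulA Wmul1 W1mul WmulV WVmul.

Definition s (i : 'Z_3) : W := Wof [:: i].

Definition wprod (u : word) : W := \prod_(i <- u) s i.

Lemma wprodE (u : word) : wprod u = Wof u.
Proof.
elim: u => [|i u IHu]; rewrite /wprod ?big_nil ?big_cons //.
by rewrite -/(wprod u) IHu [LHS]WmulE.
Qed.

(** * Length, reduced words, Bruhat order *)

Definition has_word_of_size (w : W) : pred nat :=
  fun k => `[< exists u : word, size u = k /\ wprod u = w >].

Lemma ex_word_of_size (w : W) : exists k, has_word_of_size w k.
Proof.
exists (size (repr w)); apply/asboolP; exists (repr w).
by rewrite wprodE Wof_repr.
Qed.

Definition len (w : W) : nat := ex_minn (ex_word_of_size w).

Definition reduced (u : word) : Prop := size u = len (wprod u).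

Definition reflection (t : W) : Prop := exists (w : W) (i : 'Z_3), t = s i ^ w.

Definition bruhat_step (u v : W) : Prop :=
  exists t : W, [/\ reflection t, v = u * t & (len u < len v)%N].

Definition bruhat_le : W -> W -> Prop := clos_refl_trans W bruhat_step.

(** * Folded galleries and shadows *)

(* c 0, ..., c (size u) is a possibly folded gallery of type u starting at the
   fundamental alcove; values of c beyond size u are irrelevant. *)
Definition folded_gallery (u : word) (c : nat -> W) : Prop :=
  c 0%N = 1 /\
  forall t, (t < size u)%N -> c t.+1 = c t \/ c t.+1 = c t * s (nth 0%R u t).

Definition shadow (w v : W) : Prop :=
  exists u : word, [/\ reduced u, wprod u = w &
    exists c : nat -> W, folded_gallery u c /\ v = c (size u)].

(** * Alcove coordinates *)

Definition gamma (i : 'Z_3) (k : nat) : W := \prod_(t < k) s (i + t%:R)%R.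
Definition delta (i : 'Z_3) (k : nat) : W := \prod_(t < k) s (i - t%:R)%R.

(* Negz p is the integer - p.+1. *)
Definition coord_b (n : int) : W :=
  match n with
  | Posz p => gamma 0%R p
  | Negz p => delta 2%R p.+1
  end.

Definition coord_c (n m : int) : W :=
  match m with
  | Posz p => delta (n + 1)%:~R%R p
  | Negz p => gamma (n + 2)%:~R%R p.+1
  end.

Definition alcove (n m : int) : W := coord_b n * coord_c n m.

Local Open Scope ring_scope.

Definition parity (z : int) : int := if odd `|z|%N then 1 else 0.

Definition kfun (n m c : int) : int :=
  let en := parity n in
  let em := parity m in
  if (m == 0) && (4 - 2 * n <= 2 * c <= n - en) then
    2 * divz (n + c + 1 + en) 3
  else if (m != 0) &&
      (4 - 2 * n - m + em <= 2 * c <= n - m - 2 * en + 3 * em - en * em) then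
    2 * divz (2 * n + 4 * m + 2 * c - 2 + 6 * en) 6
  else if (m != 0) &&
      (n - m + 2 - 3 * en + 3 * em <= 2 * c <= n + 2 * m - 3 * en) then
    2 * divz (4 * n + 2 * m - 2 * c + 2 - 2 * em) 6
  else 0.

(** * Programs and running time *)

(* A program works on finitely many registers holding unbounded integers and
   has read-only access to its two input words. *)

Inductive input := InX | InY.

Inductive aop := Add | Sub | Mul | FloorDiv.

(* Letter k e is the letter of input k at the position given by e, counted
   from 0, or the end marker -1 if there is no such position. *)
Inductive expr :=
| Cst of int
| Reg of nat
| Letter of input & expr
| Arith of aop & expr & expr.

Inductive test :=
| TEq of expr & expr
| TLe of expr & expr
| TLt of expr & expr
| TNot of test
| TAnd of test & test.

Inductive prog :=
| Skip
| Assign of nat & expr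
| Seq of prog & prog
| If of test & prog & prog
| While of test & prog.

Definition store := nat -> int.

Definition set_reg (st : store) (r : nat) (z : int) : store :=
  fun r' => if r' == r then z else st r'.

(* The sign makes this the floor of a / b for b < 0 too: divz rounds so that
   the remainder is nonnegative. The value is 0 for b = 0. *)
Definition floor_div (a b : int) : int := divz (a * Num.sg b) `|b|.

Definition eval_aop (o : aop) : int -> int -> int :=
  match o with
  | Add => fun a b => a + b
  | Sub => fun a b => a - b
  | Mul => fun a b => a * b
  | FloorDiv => floor_div
  end.

Definition letter_at (u : word) (z : int) : int :=
  match z with
  | Posz p => nth (- 1) [seq Posz (nat_of_ord i) | i : 'Z_3 <- u] p
  | Negz _ => - 1
  end.

Fixpoint eval_expr (x y : word) (st : store) (e : expr) : int :=
  match e with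
  | Cst z => z
  | Reg r => st r
  | Letter InX e1 => letter_at x (eval_expr x y st e1)
  | Letter InY e1 => letter_at y (eval_expr x y st e1)
  | Arith o e1 e2 =>
      eval_aop o (eval_expr x y st e1) (eval_expr x y st e2)
  end.

Fixpoint expr_cost (e : expr) : nat :=
  match e with
  | Cst _ | Reg _ => 1
  | Letter _ e1 => (expr_cost e1).+1
  | Arith _ e1 e2 => (expr_cost e1 + expr_cost e2).+1
  end.

Fixpoint eval_test (x y : word) (st : store) (b : test) : bool :=
  match b with
  | TEq e1 e2 => eval_expr x y st e1 == eval_expr x y st e2
  | TLe e1 e2 => eval_expr x y st e1 <= eval_expr x y st e2
  | TLt e1 e2 => eval_expr x y st e1 < eval_expr x y st e2
  | TNot b1 => ~~ eval_test x y st b1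
  | TAnd b1 b2 => eval_test x y st b1 && eval_test x y st b2
  end.

Fixpoint test_cost (b : test) : nat :=
  match b with
  | TEq e1 e2 | TLe e1 e2 | TLt e1 e2 => (expr_cost e1 + expr_cost e2).+1
  | TNot b1 => (test_cost b1).+1
  | TAnd b1 b2 => (test_cost b1 + test_cost b2).+1
  end.

(* exec x y p st st' t: on inputs x and y, the program p started in store st
   halts in store st' after t elementary operations. *)
Inductive exec (x y : word) : prog -> store -> store -> nat -> Prop :=
| exec_skip st : exec x y Skip st st 1
| exec_assign r e st :
    exec x y (Assign r e) st (set_reg st r (eval_expr x y st e))
      (expr_cost e).+1
| exec_seq p q st1 st2 st3 t1 t2 :
    exec x y p st1 st2 t1 -> exec x y q st2 st3 t2 ->
    exec x y (Seq p q) st1 st3 (t1 + t2)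
| exec_if_true b p q st st' t :
    eval_test x y st b -> exec x y p st st' t ->
    exec x y (If b p q) st st' (test_cost b + t).+1
| exec_if_false b p q st st' t :
    ~~ eval_test x y st b -> exec x y q st st' t ->
    exec x y (If b p q) st st' (test_cost b + t).+1
| exec_while_false b p st :
    ~~ eval_test x y st b -> exec x y (While b p) st st (test_cost b).+1
| exec_while_true b p st1 st2 st3 t1 t2 :
    eval_test x y st1 b -> exec x y p st1 st2 t1 ->
    exec x y (While b p) st2 st3 t2 ->
    exec x y (While b p) st1 st3 (test_cost b + t1 + t2).+1.

(* On inputs x and y, p halts within T operations, its answer being in
   register 0: 1 if P holds and 0 otherwise. All registers start at 0. *)
Definition decides_within (p : prog) (x y : word) (P : Prop) (T : nat) : Prop :=
  exists (st : store) (t : nat),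
    [/\ exec x y p (fun _ => 0) st t, (t <= T)%N &
        (P /\ st 0%N = 1) \/ (~ P /\ st 0%N = 0)].

(* Main.v *)
From Stdlib Require Import Relations.
Require Import Defs.
From mathcomp Require Import all_boot all_order all_algebra.
From mathcomp Require Import boolp zify.

(* W acts simply transitively on the alcoves, which get coordinates (p, c) in
   Z x Z: right multiplication by a generator moves c by one, or p by one in a
   direction given by the parity of c - p. The left reflections are explicit
   maps of Z x Z, lengthening an alcove exactly when it lies on the same side of
   the wall as the fundamental alcove. This gives the lifting property of the
   Bruhat order, hence the identification of [1, w] with the set of ends of
   folded galleries of any reduced type of w.

   The shadow of w s is Sh(w) U Sh(w)s when w s > w. In each column c the set
   cut out by kfun is an interval of values of p symmetric about 1/2, and one
   such step replaces it by that of a neighbouring column or extends it by one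
   at both ends; so the formula for the shadow follows by induction along the
   strips.

   Lifting also decides x <= y: read y backwards, replacing x by x s whenever
   this is shorter; then x <= y if and only if x ends at 1. A single pair (p, c)
   is maintained, so each letter costs O(1). *)

Set Implicit Arguments.
Unset Strict Implicit.
Unset Printing Implicit Defensive.

Import Order.TTheory GRing.Theory Num.Theory.
Local Open Scope ring_scope.

(** * Alcoves as points of the plane *)

(** Turns equalities of subscripts into integer congruences, which [lia] can decide. *)
Lemma Z3_intrP (i : 'Z_3) (z : int) :
  reflect (i = z%:~R) (((i%:Z - z) %% 3)%Z == 0).
Proof.
have valz : ((z%:~R : 'Z_3) : nat)%:Z = (z %% 3)%Z.
  rewrite [in z%:~R](divz_eq z 3) intrD intrM.
  rewrite (_ : (3%:~R : 'Z_3) = 0); last exact/val_inj.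
  rewrite mulr0 add0r -[X in X%:~R]gez0_abs ?modz_ge0 //.
  by rewrite -pmulrn val_Zp_nat //; lia.
have li : (i < 3)%N := ltn_ord i.
by apply: (iffP eqP) => [e|->]; [apply/val_inj => /=|]; lia.
Qed.

Lemma intr_Z3_eq (z z' : int) :
  ((z - z') %% 3)%Z = 0 -> z%:~R = z'%:~R :> 'Z_3.
Proof.
move=> e; apply/Z3_intrP.
have /Z3_intrP : (z%:~R : 'Z_3) = z%:~R by [].
by lia.
Qed.

(* The point (p, c) stands for the alcove (2p, c - p): p is the index of its
   even strip, and c is the column i/2 + j of the statement. *)
Definition point := (int * int)%type.

Definition move (i : 'Z_3) (a : point) : point :=
  let r := ((a.2 + i%:Z) %% 3)%Z in
  if r == 1 then (a.1, a.2 + 1) else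
  if r == 2 then (a.1, a.2 - 1) else
  (a.1 + 1 - 2 * ((a.2 - a.1) %% 2)%Z, a.2).

Variant move_spec (i : 'Z_3) (p c : int) : point -> Prop :=
| MoveUp of ((c + i%:Z) %% 3)%Z = 1 : move_spec i p c (p, c + 1)
| MoveDown of ((c + i%:Z) %% 3)%Z = 2 : move_spec i p c (p, c - 1)
| MoveRight of ((c + i%:Z) %% 3)%Z = 0 & ((c - p) %% 2)%Z = 0 :
    move_spec i p c (p + 1, c)
| MoveLeft of ((c + i%:Z) %% 3)%Z = 0 & ((c - p) %% 2)%Z = 1 :
    move_spec i p c (p - 1, c).

Lemma moveP i p c : move_spec i p c (move i (p, c)).
Proof.
rewrite /move /=.
case: eqP => [|n1]; first by constructor.
case: eqP => [|n2]; first by constructor.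
have [e|e] : ((c - p) %% 2)%Z = 0 \/ ((c - p) %% 2)%Z = 1 by lia.
  by rewrite e (_ : _ - _ = p + 1); [constructor; lia | lia].
by rewrite e (_ : _ - _ = p - 1); [constructor; lia | lia].
Qed.

(** Trades the cast [z%:~R] for an opaque generator known only by its residue, together with the
    case analysis of its move. *)
Lemma move_intrP (z : int) p c : exists2 i : 'Z_3,
  i = z%:~R & ((i%:Z - z) %% 3)%Z = 0 /\ move_spec i p c (move i (p, c)).
Proof.
exists z%:~R => //; split; last exact: moveP.
by have /Z3_intrP : (z%:~R : 'Z_3) = z%:~R by []; lia.
Qed.

Lemma moveK i : involutive (move i).
Proof.
move=> [p c]; case: (moveP i p c) => *.
all: by case: (moveP i _ _) => *; congr pair; lia.
Qed.

Lemma move_braid i j a : i != j ->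
  move i (move j (move i a)) = move j (move i (move j a)).
Proof.
move=> ij; have {ij}: (i != j :> nat) by [].
have := ltn_ord i; have := ltn_ord j; case: a => p c /=.
case: (moveP i p c) => *.
all: case: (moveP j _ _) => *; try lia.
all: case: (moveP i _ _) => *; try lia.
all: case: (moveP j _ _) => *; try lia.
all: case: (moveP i _ _) => *; try lia.
all: case: (moveP j _ _) => *; try lia.
all: by congr pair; lia.
Qed.

(* The heights of an alcove over the three families of parallel walls, the
   k-th wall of a family separating the heights k - 1 and k. *)
Definition height (f : nat) (a : point) : int :=
  match f with
  | 0 => a.1
  | 1 => ((a.2 - a.1 + 1) %/ 2)%Z
  | _ => ((a.2 + a.1) %/ 2)%Z
  end.

(** The number of walls separating [a] from the fundamental alcove, all of whose heights are 0. *)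
Definition plen (a : point) : nat :=
  `|a.1| + `|((a.2 - a.1 + 1) %/ 2)%Z| + `|((a.2 + a.1) %/ 2)%Z|.

Lemma plen_move i a :
  plen (move i a) = (plen a).+1 \/ plen a = (plen (move i a)).+1.
Proof. by case: a => p c; case: (moveP i p c) => *; rewrite /plen /=; lia. Qed.

Lemma plen_descent a : a != (0, 0) -> exists i, (plen (move i a) < plen a)%N.
Proof.
case: a => p c; rewrite xpair_eqE => a0.
have descent (z : int) : (forall i : 'Z_3, ((i%:Z - z) %% 3)%Z = 0 ->
    (plen (move i (p, c)) < plen (p, c))%N) ->
    exists i, (plen (move i (p, c)) < plen (p, c))%N.
  by move=> h; exists z%:~R; have [i <- [/h]] := move_intrP z p c.
(* [flip] says that the generator fixing the column moves [p] towards 0. If it does not, changing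
   [c] shortens: upwards when [c <= 0], downwards otherwise. *)
pose flip := (p < 0) && (((c - p) %% 2)%Z == 0) ||
  (0 < p) && (((c - p) %% 2)%Z == 1).
have [f|nf] := boolP flip.
  apply: (descent (- c)) => i ei; rewrite /plen.
  by case: (moveP i p c) => /= *; lia.
have [c0|c0] := lerP c 0.
  apply: (descent (1 - c)) => i ei; rewrite /plen.
  by case: (moveP i p c) => /= *; lia.
apply: (descent (2 - c)) => i ei; rewrite /plen.
by case: (moveP i p c) => /= *; lia.
Qed.

(** The reflection in the [k]-th wall of family [f]; it sends height [h] of that family to
    [2k - 1 - h]. *)
Definition reflect_at (f : nat) (k : int) (a : point) : point :=
  match f with
  | 0 => (2 * k - 1 - a.1, a.2)
  | 1 => (height 2 a - k + 1, 3 * k - 2 + a.1 - height 1 a)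
  | _ => (k - height 1 a, 3 * k - 1 - a.1 - height 2 a)
  end.

(** Reflections act on the left and moves on the right. *)
Lemma reflect_at_move f k i a :
  reflect_at f k (move i a) = move i (reflect_at f k a).
Proof.
case: a => p c; case: f => [|[|f]]; case: (moveP i p c) => *.
all: rewrite /reflect_at /height /=; case: (moveP i _ _) => *; try lia.
all: by congr pair; lia.
Qed.

(** Adjacent alcoves are exchanged by the reflection in their common wall; its index is the larger
    of their two heights in the family crossed. *)
Lemma move_reflect_at i a : exists f k, move i a = reflect_at f k a.
Proof.
case: a => p c; case: (moveP i p c) => *.
- have [e|e] : ((c - p) %% 2)%Z = 0 \/ ((c - p) %% 2)%Z = 1 by lia.
    by exists 1%N, (height 1 (p, c) + 1); congr pair; rewrite /height /=; lia.
  by exists 2%N, (height 2 (p, c) + 1); congr pair; rewrite /height /=; lia.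
- have [e|e] : ((c - p) %% 2)%Z = 0 \/ ((c - p) %% 2)%Z = 1 by lia.
    by exists 2%N, (height 2 (p, c)); congr pair; rewrite /height /=; lia.
  by exists 1%N, (height 1 (p, c)); congr pair; rewrite /height /=; lia.
- by exists 0%N, (p + 1); congr pair; rewrite /=; lia.
- by exists 0%N, p; congr pair; rewrite /=; lia.
Qed.

(** A move crosses only the wall common to both alcoves, so it stays on the same side of any other
    wall. *)
Lemma height_move f k i a :
  move i a <> reflect_at f k a ->
  (k <= height f (move i a)) = (k <= height f a).
Proof.
case: a => p c; case: f => [|[|f]]; case: (moveP i p c) => *; apply/idP/idP.
all: rewrite /height /reflect_at /= => le; rewrite leNgt; apply/negP => lt.
all: try lia; match goal with H : _ <> _ |- _ => apply: H end.
all: by congr pair; rewrite /height /=; lia.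
Qed.

(** The fundamental alcove has height 0, so [k <= 0] records its side of the wall. *)
Lemma plen_reflect_at f k a :
  (plen a < plen (reflect_at f k a))%N = ((k <= height f a) == (k <= 0)).
Proof.
case: a => p c; rewrite /plen.
by case: f => [|[|f]]; rewrite /reflect_at /height /=; lia.
Qed.

Lemma plen_reflect_at_gt f k a :
  (plen (reflect_at f k a) < plen a)%N = ((k <= height f a) != (k <= 0)).
Proof.
case: a => p c; rewrite /plen.
by case: f => [|[|f]]; rewrite /reflect_at /height /=; lia.
Qed.

Definition walk : point -> word -> point := foldl (fun a i => move i a).

Lemma walk_rcons a u i : walk a (rcons u i) = move i (walk a u).
Proof. by rewrite /walk -cats1 foldl_cat. Qed.

(* [folds r a] says that a folded gallery of type [rev r] ends at [a]. *)
Fixpoint folds (r : word) (a : point) : Prop :=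
  if r is i :: r' then folds r' a \/ folds r' (move i a) else a = (0, 0).

(** The reflection commutes with the last step of the gallery. Either it is that step, and folding
    or unfolding it suffices, or it still shortens the alcove before the step. *)
Lemma folds_reflect_at r f k a : folds r a ->
  (plen (reflect_at f k a) < plen a)%N -> folds r (reflect_at f k a).
Proof.
elim: r a => [|i r IHr] a /=; first by move->.
have [<-|/eqP ne] := eqVneq (move i a) (reflect_at f k a).
  by rewrite moveK; tauto.
case=> [ra|ra] lt; first by left; apply: IHr.
right; rewrite -reflect_at_move; apply: IHr => //.
by rewrite plen_reflect_at_gt height_move // -plen_reflect_at_gt.
Qed.

Fixpoint descend (r : word) (a : point) : point :=
  if r is i :: r' then
    descend r' (if (plen (move i a) < plen a)%N then move i a else a)
  else a.

(** The alcoves [a] and [move i a] differ by a reflection, so if one of them is an end for [r], then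
    so is the shorter one: the greedy choice loses nothing. *)
Lemma folds_descend r a : folds r a <-> descend r a = (0, 0).
Proof.
elim: r a => [|i r IHr] a //=; rewrite -IHr.
have [f [k e]] := move_reflect_at i a.
case: ifP => [lt|/negbT ge]; split=> [[]|] //; try by [left | right].
  by rewrite e in lt * => ra; apply: folds_reflect_at.
have ea : reflect_at f k (move i a) = a by rewrite reflect_at_move -e moveK.
move=> ra; rewrite -ea; apply: folds_reflect_at => //.
by rewrite ea; case: (plen_move i a) => h; lia.
Qed.

Lemma folds_walk u : folds (rev u) (walk (0, 0) u).
Proof.
elim/last_ind: u => [|u i IHu] //.
by rewrite rev_rcons walk_rcons /= moveK; right.
Qed.

(** * The action of W *)

Local Open Scope group_scope.

Lemma s_mul (i : 'Z_3) : s i * s i = 1.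
Proof. by rewrite /s [LHS]WmulE; apply/WofP/weq_invol. Qed.

Lemma mulsK (i : 'Z_3) (x : W) : x * s i * s i = x.
Proof. by rewrite -mulgA s_mul mulg1. Qed.

Lemma invs (i : 'Z_3) : (s i)^-1 = s i.
Proof. by apply: (mulgI (s i)); rewrite mulgV s_mul. Qed.

Lemma s_braid (i j : 'Z_3) : i != j -> s i * s j * s i = s j * s i * s j.
Proof.
have H (k l : 'Z_3) : (k < l)%N -> s k * s l * s k = s l * s k * s l.
  move=> kl; have e : s k * s l * s k * s l * s k * s l = 1.
    have /WofP := weq_braid kl.
    by rewrite -!wprodE /wprod !big_cons big_nil mulg1 !mulgA.
  by rewrite -[RHS]mul1g -e !mulgA !mulsK.
by rewrite -val_eqE neq_ltn => /orP[/H // | /H ->].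
Qed.

Lemma wprod_cat u v : wprod (u ++ v) = wprod u * wprod v.
Proof. by rewrite /wprod big_cat. Qed.

Lemma wprod_rcons u i : wprod (rcons u i) = wprod u * s i.
Proof. by rewrite /wprod big_rcons. Qed.

Lemma wprod_surj x : exists u, x = wprod u.
Proof. by exists (repr x); rewrite wprodE Wof_repr. Qed.

(** The defining relations act trivially, so walks give a right action of [W] on points. *)
Lemma walk_weq u v : weq u v -> walk^~ u =1 walk^~ v.
Proof.
move=> uv a; elim: uv a => {u v} //=
  [u v w _ IHu _ IHv a|u u' v v' _ IHu _ IHv a|i a|i j ij a].
- by rewrite IHu.
- by rewrite /walk !foldl_cat -!/(walk _ _) IHu IHv.
- by rewrite moveK.
by rewrite [move i (move j (move i _))]move_braid ?moveK // -val_eqE neq_ltn ij.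
Qed.

Definition point_of (x : W) : point := walk (0, 0)%R (repr x).

Lemma point_of_wprod u : point_of (wprod u) = walk (0, 0)%R u.
Proof. by apply: walk_weq; rewrite wprodE; apply: weq_repr. Qed.

Lemma point_of1 : point_of 1 = (0, 0)%R.
Proof. by have := point_of_wprod [::]; rewrite /wprod big_nil. Qed.

Lemma point_of_mul x u : point_of (x * wprod u) = walk (point_of x) u.
Proof.
have [v ->] := wprod_surj x.
by rewrite -wprod_cat !point_of_wprod /walk foldl_cat.
Qed.

Lemma point_of_s x i : point_of (x * s i) = move i (point_of x).
Proof. by have := point_of_mul x [:: i]; rewrite /wprod big_seq1. Qed.

(** For [m >= 0] the generator is the next letter of [delta]; for [m < 0] it cancels the last letter
    of [gamma]. *)
Lemma alcove_up (n m : int) :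
  alcove n m * s (n + 1 - m)%:~R%R = alcove n (m + 1)%R.
Proof.
rewrite /alcove -mulgA; congr (_ * _); case: m => [m|m].
  rewrite (_ : (m%:Z + 1)%R = Posz m.+1) /=; last by lia.
  by rewrite /delta big_ord_recr /= pmulrn -rmorphB.
rewrite /coord_c /gamma big_ord_recr /=.
have -> : (n + 1 - Negz m)%:~R%R = ((n + 2)%:~R + m%:R)%R :> 'Z_3.
  by rewrite [m%:R%R]pmulrn -intrD; apply: intr_Z3_eq; lia.
rewrite mulsK; case: m => [|m].
  by rewrite big_ord0 (_ : (_ + 1)%R = Posz 0) /= /delta ?big_ord0 //; lia.
by rewrite (_ : (_ + 1)%R = Negz m) //; lia.
Qed.

Lemma alcove_down (n m : int) :
  alcove n m * s (n + 2 - m)%:~R%R = alcove n (m - 1)%R.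
Proof.
rewrite (_ : alcove n m = alcove n (m - 1 + 1)%R); last by congr alcove; lia.
rewrite -alcove_up (_ : (n + 2 - m)%R = (n + 1 - (m - 1))%R); last by lia.
by rewrite mulsK.
Qed.

Lemma coord_b_succ (n : int) : coord_b n * s n%:~R%R = coord_b (n + 1)%R.
Proof.
case: n => n.
  rewrite (_ : (n%:Z + 1)%R = Posz n.+1) /=; last by lia.
  by rewrite /gamma big_ord_recr /= add0r.
rewrite /coord_b /delta big_ord_recr /=.
have -> : (Negz n)%:~R%R = (2 - n%:R)%R :> 'Z_3.
  by rewrite [n%:R%R]pmulrn -(intrB _ 2); apply: intr_Z3_eq; lia.
rewrite mulsK; case: n => [|n].
  by rewrite big_ord0 (_ : (_ + 1)%R = Posz 0) /= /gamma ?big_ord0 //; lia.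
by rewrite (_ : (_ + 1)%R = Negz n) //; lia.
Qed.

Lemma alcove0 n : alcove n 0%R = coord_b n.
Proof. by rewrite /alcove /= /delta big_ord0 mulg1. Qed.

(** Two steps along either strip multiply by the same [b * a], and [b * a * b = a * b * a] carries
    one crossing to the other. *)
Lemma alcove_cross_step (n m : int) :
  (alcove n m * s (n - m)%:~R%R = alcove (n + 2)%R (m - 1)%R) <->
  (alcove n (m + 2)%R * s (n - (m + 2))%:~R%R
     = alcove (n + 2)%R (m + 2 - 1)%R).
Proof.
set a := s (n - m)%:~R%R; set b := s (n + 1 - m)%:~R%R.
have ab : a * b * a = b * a * b.
  apply: s_braid; apply/eqP => /Z3_intrP.
  have /Z3_intrP : ((n - m)%:~R : 'Z_3)%R = (n - m)%:~R%R by [].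
  by lia.
have -> : s (n - (m + 2))%:~R%R = b by congr s; apply: intr_Z3_eq; lia.
have -> : alcove n (m + 2)%R = alcove n m * b * a.
  rewrite (_ : (m + 2)%R = (m + 1 + 1)%R); last by lia.
  by rewrite -!alcove_up; congr (_ * s _); apply: intr_Z3_eq; lia.
have -> : alcove (n + 2)%R (m + 2 - 1)%R = alcove (n + 2)%R (m - 1)%R * b * a.
  rewrite (_ : (m + 2 - 1)%R = (m - 1 + 1 + 1)%R); last by lia.
  rewrite -!alcove_up; congr (_ * s _ * s _); apply: intr_Z3_eq; lia.
rewrite -[_ * b * a * b]mulgA -[_ * b * (a * b)]mulgA [b * (a * b)]mulgA -ab.
by rewrite !mulgA; split=> [->|] // /mulIg /mulIg.
Qed.

(** At [m = 0] both sides are [coord_b (n + 1)]; steps of two in both directions reach every even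
    [m]. *)
Lemma alcove_cross (n m : int) : (m %% 2)%Z = 0%R ->
  alcove n m * s (n - m)%:~R%R = alcove (n + 2)%R (m - 1)%R.
Proof.
have base : alcove n 0%R * s (n - 0)%:~R%R = alcove (n + 2)%R (0 - 1)%R.
  rewrite subr0 alcove0 coord_b_succ -alcove_down alcove0.
  rewrite (_ : (n + 2)%R = (n + 1 + 1)%R); last by lia.
  rewrite -(coord_b_succ (n + 1)%R) -[LHS](mulsK (n + 1)%:~R%R).
  by congr (_ * s _); apply: intr_Z3_eq; lia.
move=> m2; have [[k ->]|[k ->]] :
    (exists k : nat, m = (k%:Z * 2)%R) \/
    (exists k : nat, m = (- (k%:Z * 2))%R).
  by have [m0|m0] := lerP 0%R m; [left|right]; exists `|(m %/ 2)%Z|%N; lia.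
- elim: k => [|k IHk]; first by rewrite mul0r.
  rewrite (_ : (k.+1%:Z * 2)%R = (k%:Z * 2 + 2)%R); last by lia.
  exact: (alcove_cross_step _ _).1 IHk.
elim: k => [|k IHk]; first by rewrite mul0r oppr0.
apply: (alcove_cross_step _ _).2.
by rewrite (_ : (- (k.+1%:Z * 2) + 2)%R = (- (k%:Z * 2))%R); last by lia.
Qed.

Definition alcove_at (a : point) : W := alcove (2 * a.1)%R (a.2 - a.1)%R.

Lemma alcove_at_move i a : alcove_at (move i a) = alcove_at a * s i.
Proof.
case: a => p c; case: (moveP i p c) => *; rewrite /alcove_at /=.
- have -> : i = (2 * p + 1 - (c - p))%:~R%R by apply/Z3_intrP; lia.
  by rewrite alcove_up; congr alcove; lia.
- have -> : i = (2 * p + 2 - (c - p))%:~R%R by apply/Z3_intrP; lia.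
  by rewrite alcove_down; congr alcove; lia.
- have -> : i = (2 * p - (c - p))%:~R%R by apply/Z3_intrP; lia.
  by rewrite alcove_cross; [congr alcove; lia | lia].
have -> : i = (2 * (p - 1) - (c - (p - 1)))%:~R%R by apply/Z3_intrP; lia.
rewrite -[LHS](mulsK (2 * (p - 1) - (c - (p - 1)))%:~R%R).
by rewrite alcove_cross; [congr (alcove _ _ * _); lia | lia].
Qed.

Lemma point_ofK : cancel point_of alcove_at.
Proof.
move=> x; have [u ->] := wprod_surj x; elim/last_ind: u => [|u i IHu].
  by rewrite /wprod big_nil point_of1 /alcove_at /= alcove0 /= /gamma big_ord0.
by rewrite wprod_rcons point_of_s alcove_at_move IHu.
Qed.

(** Descents lead from any point to (0, 0), so the action is transitive; [point_ofK] makes it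
    free. *)
Lemma alcove_atK : cancel alcove_at point_of.
Proof.
move=> a; have [n] := ubnP (plen a); elim: n a => // n IHn a an.
have [->|/plen_descent [i lt]] := eqVneq a (0, 0)%R.
  by rewrite -point_of1 point_ofK.
rewrite -[a](moveK i) alcove_at_move point_of_s IHn //.
exact: leq_trans lt an.
Qed.

Lemma plen_walk u : (plen (walk (0, 0)%R u) <= size u)%N.
Proof.
elim/last_ind: u => [|u i IHu] //; rewrite walk_rcons size_rcons.
by case: (plen_move i (walk (0, 0)%R u)) => h; lia.
Qed.

(** A letter changes [plen] by one, so no word is shorter than [plen]; a chain of descents, read
    backwards, spells a word of exactly that length. *)
Lemma len_plen x : len x = plen (point_of x).
Proof.
rewrite /len; case: ex_minnP => k /asboolP [u [<- <-]] min_u.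
rewrite point_of_wprod; apply/eqP; rewrite eqn_leq plen_walk andbT.
apply: min_u; apply/asboolP.
rewrite -[wprod u]point_ofK point_of_wprod.
move: (walk _ u) => a {u}.
have [n] := ubnP (plen a); elim: n a => // n IHn a an.
have [->|/plen_descent [i lt]] := eqVneq a (0, 0)%R.
  by exists [::]; rewrite -point_of1 point_ofK /wprod big_nil point_of1.
have [|v [sv ev]] := IHn (move i a); first exact: leq_trans lt an.
exists (rcons v i); rewrite size_rcons sv wprod_rcons ev alcove_at_move mulsK.
by split=> //; case: (plen_move i a) => h; lia.
Qed.

(** * Shadows and the Bruhat order *)

Lemma galleryP u v :
  (exists c, folded_gallery u c /\ v = c (size u)) <->
  folds (rev u) (point_of v).
Proof.
elim/last_ind: u v => [|u i IHu] v.
  split=> [[c [[c0 _] ->]]|e]; first by rewrite c0 /= point_of1.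
  exists (fun=> 1); split=> //.
  by apply: (can_inj point_ofK); rewrite point_of1.
rewrite rev_rcons /= -point_of_s -!IHu size_rcons; split.
  case=> c [[c0 cS] ->].
  have cu : folded_gallery u c.
    split=> // t tu; have := cS t; rewrite size_rcons nth_rcons tu; apply.
    exact: leqW.
  have := cS (size u); rewrite size_rcons nth_rcons ltnn eqxx => /(_ (leqnn _)).
  by case=> ->; [left|right]; exists c; rewrite ?mulsK.
move=> h.
have {h} [c [[c0 cS] vc]] : exists c : nat -> W, folded_gallery u c /\
    (v = c (size u) \/ v = c (size u) * s i).
  case: h => [[c [cu vc]]|[c [cu vc]]]; exists c; split=> //; first by left.
  by right; rewrite -vc mulsK.
(* Values beyond [size u] are arbitrary for the type [u], so the new end [v] is put there. *)
exists (fun t => if (t <= size u)%N then c t else v); split.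
  2: by rewrite ltnn.
split=> // t; rewrite size_rcons ltnS leq_eqVlt nth_rcons => /orP[/eqP->|tu].
  by rewrite ltnn eqxx.
by rewrite tu orbT; apply: cS.
Qed.

Lemma shadowP w v : shadow w v <->
  exists u, [/\ reduced u, wprod u = w & folds (rev u) (point_of v)].
Proof.
split=> [[u [ru wu /galleryP fu]]|[u [ru wu /galleryP fu]]]; by exists u.
Qed.

Lemma reflection_s i : reflection (s i).
Proof. by exists 1, i; rewrite conjg1. Qed.

Lemma reflectionJ t w : reflection t -> reflection (t ^ w).
Proof. by case=> v [i ->]; exists (v * w), i; rewrite conjgM. Qed.

Lemma reflection_mul t : reflection t -> t * t = 1.
Proof. by case=> w [i ->]; rewrite -conjMg s_mul conj1g. Qed.

(** With [t = s i ^ w], the product [x * t] is [x * w^-1 * s i * w]: the move [i] is a reflection,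
    which commutes with the walk along [w]. *)
Lemma point_of_reflection x t : reflection t ->
  exists f k, point_of (x * t) = reflect_at f k (point_of x).
Proof.
case=> w [i ->]; have [f [k e]] := move_reflect_at i (point_of (x * w^-1)).
exists f, k; have [u wu] := wprod_surj w.
have := mulgVK w x; rewrite conjgE !mulgA; move: (x * w^-1) e => y e <-.
rewrite wu !point_of_mul point_of_s e; elim/last_ind: {wu} u => [|u j IHu] //.
by rewrite !walk_rcons IHu reflect_at_move.
Qed.

(** Conjugating [t] by [s i] keeps the same wall on the left, and [x * s i <> y] says that the move
    by [i] does not cross it. *)
Lemma bruhat_step_mulr x y i : bruhat_step x y -> x * s i <> y ->
  bruhat_step (x * s i) (y * s i).
Proof.
case=> t [rt -> lt] ne; exists (t ^ s i); split; first exact: reflectionJ.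
  by rewrite conjgE invs !mulgA mulsK.
have [f [k e]] := point_of_reflection x rt.
rewrite !len_plen !point_of_s e -reflect_at_move plen_reflect_at.
rewrite height_move -?plen_reflect_at -?e -?len_plen //.
by rewrite -point_of_s => /(can_inj point_ofK).
Qed.

Lemma bruhat_step_s (x : W) i :
  (len x < len (x * s i)%g)%N -> bruhat_step x (x * s i).
Proof. by move=> lt; exists (s i); split=> //; apply: reflection_s. Qed.

(** The chain from [x] to [y] is multiplied by [s i] link by link; at a link that is itself
    multiplication by [s i], the rest of the chain is kept as it is. *)
Lemma bruhat_le_mulr x y i : bruhat_le x y ->
  bruhat_le (x * s i) (y * s i) \/ bruhat_le (x * s i) y.
Proof.
move=> le; have {le} := clos_rt_rt1n _ _ _ _ le.
elim=> {x y} [x|x z y xz zy IH]; first by left; apply: rt_refl.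
have [e|/eqP ne] := eqVneq (x * s i) z.
  by right; rewrite e; apply: clos_rt1n_rt.
have st := bruhat_step_mulr xz ne.
by case: IH => h; [left|right]; apply: rt_trans h; apply: rt_step.
Qed.

Lemma len_le_size u : (len (wprod u) <= size u)%N.
Proof. by rewrite len_plen point_of_wprod plen_walk. Qed.

Lemma reduced_rcons u i : reduced (rcons u i) ->
  reduced u /\ (len (wprod u) < len (wprod u * s i)%g)%N.
Proof.
rewrite /reduced size_rcons wprod_rcons => e; have := len_le_size u.
move: e; rewrite !len_plen point_of_s.
by case: (plen_move i (point_of (wprod u))) => h; lia.
Qed.

Lemma bruhat_le_folds x y r :
  bruhat_le x y -> folds r (point_of y) -> folds r (point_of x).
Proof.
elim=> {x y} [x y [t [rt -> lt]]|//|x y z _ IH1 _ IH2 rz]; last by auto.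
have [f [k e]] := point_of_reflection (x * t) rt.
have {e} ex : point_of x = reflect_at f k (point_of (x * t)).
  by rewrite -e -mulgA reflection_mul // mulg1.
by move=> ry; rewrite ex; apply: folds_reflect_at; rewrite // -ex -!len_plen.
Qed.

Lemma folds_bruhat_le u x : reduced u ->
  folds (rev u) (point_of x) -> bruhat_le x (wprod u).
Proof.
elim/last_ind: u x => [|u i IHu] x.
  move=> _ /= e; rewrite /wprod big_nil -[x]point_ofK e -point_of1 point_ofK.
  exact: rt_refl.
move=> /reduced_rcons [ru lt]; rewrite rev_rcons wprod_rcons /= -point_of_s.
have le : bruhat_le (wprod u) (wprod u * s i).
  exact/rt_step/bruhat_step_s.
case=> /(IHu _ ru) h; first exact: rt_trans le.
case: (bruhat_le_mulr i h); rewrite mulsK // => h'; exact: rt_trans le.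
Qed.

Lemma bruhat_leP u x : reduced u ->
  bruhat_le x (wprod u) <-> folds (rev u) (point_of x).
Proof.
move=> ru; split=> [le|]; last exact: folds_bruhat_le.
by apply: bruhat_le_folds le _; rewrite point_of_wprod; apply: folds_walk.
Qed.

Lemma ex_reduced w : exists u, reduced u /\ wprod u = w.
Proof.
have: has_word_of_size w (len w) by rewrite /len; case: ex_minnP.
by move=> /asboolP [u [su wu]]; exists u; rewrite /reduced wu.
Qed.

Lemma shadow_bruhat_le w v : shadow w v <-> bruhat_le v w.
Proof.
rewrite shadowP; split=> [[u [ru <-]]|le]; first by move/bruhat_leP; apply.
have [u [ru wu]] := ex_reduced w; exists u; split=> //.
by apply/bruhat_leP; rewrite ?wu.
Qed.

Lemma bruhat_le_len x y : bruhat_le x y -> (len x <= len y)%N.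
Proof.
by elim=> {x y} [x y [t [_ _ /ltnW]]|x|x y z _ le1 _] //; apply: leq_trans.
Qed.

Local Close Scope group_scope.

(** * The shadow of the alcove (n, m) *)

(* As k is even, the condition on i = 2p reads 1 - k/2 <= p <= k/2, an
   interval symmetric about 1/2, in every column c. *)
Definition in_kfun (n m : int) (a : point) : Prop :=
  2 - kfun n m a.2 <= 2 * a.1 /\ 2 * a.1 <= kfun n m a.2.

Lemma parityE z : parity z = (z %% 2)%Z.
Proof. by rewrite /parity; case: ifP; lia. Qed.

(** The floors disappear because [p] is an integer; in the other columns [kfun] is 0, and
    [2 <= 2 * p <= 0] is impossible. *)
Lemma in_kfun0 n p c (en := (n %% 2)%Z) : in_kfun n 0 (p, c) <->
  (4 - 2 * n <= 2 * c /\ 2 * c <= n - en) /\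
  (3 * p <= n + c + 1 + en /\ 3 * (1 - p) <= n + c + 1 + en).
Proof.
rewrite /in_kfun /kfun /= !parityE -/en.
by case: ifP => [/andP[]|/negbT]; rewrite ?negb_and; lia.
Qed.

(** The two ranges of columns are disjoint, so the successive tests of [kfun] become a plain
    disjunction. *)
Lemma in_kfun_pos n m p c (en := (n %% 2)%Z) (em := (m %% 2)%Z) : 0 < m ->
  in_kfun n m (p, c) <->
  (4 - 2 * n - m + em <= 2 * c /\
    2 * c <= n - m - 2 * en + 3 * em - en * em) /\
  (6 * p <= 2 * n + 4 * m + 2 * c - 2 + 6 * en /\
    6 * (1 - p) <= 2 * n + 4 * m + 2 * c - 2 + 6 * en) \/
  (n - m + 2 - 3 * en + 3 * em <= 2 * c /\ 2 * c <= n + 2 * m - 3 * en) /\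
  (6 * p <= 4 * n + 2 * m - 2 * c + 2 - 2 * em /\
    6 * (1 - p) <= 4 * n + 2 * m - 2 * c + 2 - 2 * em).
Proof.
move=> m0; rewrite /in_kfun /kfun /= !parityE -/en -/em.
rewrite (_ : m == 0 = false) /=; last by lia.
have [-> | ->] : en = 0 \/ en = 1 by lia.
all: have [-> | ->] : em = 0 \/ em = 1 by lia.
all: case: ifP => [/andP[]|/negbT]; rewrite ?negb_and; try lia.
all: by case: ifP => [/andP[]|/negbT]; rewrite ?negb_and; lia.
Qed.

(** This lemma and the next two match the recursion of [folds] when a letter is appended: the next
    one of [coord_b], the first of [coord_c], a later one of [coord_c]. The second stands apart
    because [kfun] treats [m = 0] by its own clause. *)
Lemma in_kfun0_step (n : int) (a : point) : 2 <= n ->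
  in_kfun (n + 1) 0 a <-> in_kfun n 0 a \/ in_kfun n 0 (move n%:~R a).
Proof.
case: a => p c n2; have [i <- [ei]] := move_intrP n p c.
have [en|en] : (n %% 2)%Z = 0 \/ (n %% 2)%Z = 1 by lia.
all: have en1 : ((n + 1) %% 2)%Z = 1 - (n %% 2)%Z by lia.
all: by case=> *; rewrite !in_kfun0 en1 en; lia.
Qed.

Lemma in_kfun1_step (n : int) (a : point) : 2 <= n ->
  in_kfun n 1 a <-> in_kfun n 0 a \/ in_kfun n 0 (move (n + 1)%:~R a).
Proof.
case: a => p c n2; have [i <- [ei]] := move_intrP (n + 1) p c.
have [en|en] : (n %% 2)%Z = 0 \/ (n %% 2)%Z = 1 by lia.
all: by case=> *; rewrite !in_kfun0 !in_kfun_pos //= en; lia.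
Qed.

Lemma in_kfun_step (n m : int) (a : point) : 2 <= n -> 0 < m ->
  in_kfun n (m + 1) a <-> in_kfun n m a \/ in_kfun n m (move (n + 1 - m)%:~R a).
Proof.
case: a => p c n2 m0; have [i <- [ei]] := move_intrP (n + 1 - m) p c.
have em1 : ((m + 1) %% 2)%Z = 1 - (m %% 2)%Z by lia.
have [en|en] : (n %% 2)%Z = 0 \/ (n %% 2)%Z = 1 by lia.
all: have [em|em] : (m %% 2)%Z = 0 \/ (m %% 2)%Z = 1 by lia.
all: case=> *; rewrite !in_kfun_pos ?em1 ?en ?em; try lia.
Qed.

Definition alcove_word (n m : nat) : word :=
  mkseq (fun t => (t%:Z)%:~R) n ++ mkseq (fun t => (n%:Z + 1 - t%:Z)%:~R) m.

Lemma alcove_word_succl n :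
  alcove_word n.+1 0 = rcons (alcove_word n 0) (n%:Z)%:~R.
Proof. by rewrite /alcove_word [mkseq _ 0]/= !cats0 mkseqS. Qed.

Lemma alcove_word_succr n m :
  alcove_word n m.+1 = rcons (alcove_word n m) (n%:Z + 1 - m%:Z)%:~R.
Proof. by rewrite /alcove_word mkseqS rcons_cat. Qed.

Lemma size_alcove_word n m : size (alcove_word n m) = (n + m)%N.
Proof. by rewrite size_cat !size_mkseq. Qed.

Lemma wprod_alcove_word (n m : nat) : wprod (alcove_word n m) = alcove n m.
Proof.
elim: m => [|m IHm]; last first.
  by rewrite alcove_word_succr wprod_rcons IHm alcove_up; congr alcove; lia.
elim: n => [|n IHn]; first by rewrite alcove0 /wprod big_nil /= /gamma big_ord0.
rewrite alcove_word_succl wprod_rcons IHn !alcove0 coord_b_succ.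
by congr coord_b; lia.
Qed.

(** Points use even strips only. Along an odd strip, the steps alternately lower [c] and raise
    [p]. *)
Definition alcove_point (n m : nat) : point :=
  if (n %% 2 == 0)%N then ((n %/ 2)%N%:Z, (n %/ 2 + m)%N%:Z)
  else ((n %/ 2 + m %/ 2)%N%:Z + 1, (n %/ 2)%N%:Z - (m.+1 %/ 2)%N%:Z).

Lemma walk_alcove_word (n m : nat) :
  walk (0, 0) (alcove_word n m) = alcove_point n m.
Proof.
elim: m => [|m IHm].
  elim: n => [|n IHn] //.
  rewrite alcove_word_succl walk_rcons IHn /alcove_point.
  case: ifP => n2.
    have [i <- [ei]] := move_intrP n (n %/ 2)%N%:Z (n %/ 2 + 0)%N%:Z.
    by rewrite ifF; [case=> *; congr pair|]; lia.
  have [i <- [ei]] := move_intrP n ((n %/ 2 + 0 %/ 2)%N%:Z + 1)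
    ((n %/ 2)%N%:Z - (1 %/ 2)%N%:Z).
  by rewrite ifT; [case=> *; congr pair|]; lia.
rewrite alcove_word_succr walk_rcons IHm /alcove_point.
case: ifP => n2.
  have [i <- [ei]] := move_intrP (n%:Z + 1 - m%:Z)
    (n %/ 2)%N%:Z (n %/ 2 + m)%N%:Z.
  by case=> *; congr pair; lia.
have [i <- [ei]] := move_intrP (n%:Z + 1 - m%:Z)
  ((n %/ 2 + m %/ 2)%N%:Z + 1) ((n %/ 2)%N%:Z - (m.+1 %/ 2)%N%:Z).
by case=> *; congr pair; lia.
Qed.

Lemma reduced_alcove_word n m : reduced (alcove_word n m).
Proof.
rewrite /reduced len_plen point_of_wprod walk_alcove_word size_alcove_word.
by rewrite /alcove_point /plen; case: ifP => /=; lia.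
Qed.

Lemma folds_alcove_word (n m : nat) a : (2 <= n)%N ->
  folds (rev (alcove_word n m)) a <-> in_kfun n m a.
Proof.
move=> n2; elim: m a => [|m IHm] a; last first.
  rewrite alcove_word_succr rev_rcons /= !IHm.
  rewrite (_ : m.+1%:Z = m%:Z + 1); last by lia.
  case: m {IHm} => [|m]; last by rewrite -in_kfun_step //; lia.
  by rewrite subr0 -in_kfun1_step //; lia.
elim: n n2 a => // n IHn; rewrite leq_eqVlt => /orP[/eqP n2|n2] a; last first.
  rewrite alcove_word_succl rev_rcons /= !IHn // -in_kfun0_step; last by lia.
  by rewrite (_ : n.+1%:Z = n%:Z + 1); last by lia.
(* The induction starts at [n = 2], with the word of letters 0 and 1; the ends of its four foldings
   are compared directly. *)
case: a => p c; rewrite -n2 in_kfun0 /=.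
have pairE (q d q' d' : int) : (q, d) = (q', d') <-> q = q' /\ d = d'.
  by split=> [[]|[-> ->]].
have [j <- [ej mj]] := move_intrP 0 p c; have [i <- [ei]] := move_intrP 1 p c.
case=> *; case: mj => *; case: (moveP j _ _) => *; rewrite !pairE; lia.
Qed.

Lemma shadow_alcove (n m : nat) v : (2 <= n)%N ->
  shadow (alcove n m) v <-> in_kfun n m (point_of v).
Proof.
move=> n2; rewrite shadow_bruhat_le -wprod_alcove_word.
by rewrite bruhat_leP ?folds_alcove_word //; apply: reduced_alcove_word.
Qed.

(** * The linear-time algorithm *)

Fixpoint loop_free (p : prog) : bool :=
  match p with
  | Skip | Assign _ _ => true
  | Seq p1 p2 | If _ p1 p2 => loop_free p1 && loop_free p2
  | While _ _ => false
  end.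

(* [run] ignores loops; [max_cost] only counts one round of them. *)
Fixpoint run (x y : word) (p : prog) (st : store) : store :=
  match p with
  | Skip | While _ _ => st
  | Assign r e => set_reg st r (eval_expr x y st e)
  | Seq p1 p2 => run x y p2 (run x y p1 st)
  | If b p1 p2 => if eval_test x y st b then run x y p1 st else run x y p2 st
  end.

Fixpoint max_cost (p : prog) : nat :=
  match p with
  | Skip => 1
  | Assign _ e => (expr_cost e).+1
  | Seq p1 p2 => max_cost p1 + max_cost p2
  | If b p1 p2 => (test_cost b + maxn (max_cost p1) (max_cost p2)).+1
  | While b p1 => (test_cost b + max_cost p1).+1
  end.

Definition runs_within x y p st st' T :=
  exists2 t, exec x y p st st' t & (t <= T)%N.

Lemma run_loop_free x y p st :
  loop_free p -> runs_within x y p st (run x y p st) (max_cost p).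
Proof.
elim: p st => [|r e|p IHp q IHq|b p IHp q IHq|//] st /=.
- by exists 1%N => //; constructor.
- by exists (expr_cost e).+1 => //; constructor.
- case/andP=> /IHp{}IHp /IHq{}IHq; have [t1 e1 l1] := IHp st.
  have [t2 e2 l2] := IHq (run x y p st).
  by exists (t1 + t2)%N; [apply: exec_seq e1 e2 | apply: leq_add].
case/andP=> /IHp{}IHp /IHq{}IHq; case: ifP => [bT|/negbT bF].
  have [t1 e1 l1] := IHp st; exists (test_cost b + t1).+1; last by lia.
  exact: exec_if_true.
have [t1 e1 l1] := IHq st; exists (test_cost b + t1).+1; last by lia.
exact: exec_if_false.
Qed.

(** Each round, like the final failing test, is charged [max_cost (While b p)], so [n] rounds cost
    at most [n + 1] times that. *)
Lemma runs_within_while x y b p st1 st2 T :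
  eval_test x y st1 b -> loop_free p ->
  runs_within x y (While b p) (run x y p st1) st2 T ->
  runs_within x y (While b p) st1 st2 (max_cost (While b p) + T).
Proof.
move=> bT /(run_loop_free x y st1)[t1 e1 l1] [t2 e2 l2].
exists (test_cost b + t1 + t2).+1; first exact: exec_while_true e1 e2.
by rewrite /=; lia.
Qed.

Lemma runs_within_while_end x y b p st :
  ~~ eval_test x y st b ->
  runs_within x y (While b p) st st (max_cost (While b p)).
Proof.
move=> bF; exists (test_cost b).+1; first exact: exec_while_false.
by rewrite /=; lia.
Qed.

Lemma floor_div_pos a b : 0 < b -> floor_div a b = (a %/ b)%Z.
Proof. by move=> b0; rewrite /floor_div gtr0_sg // mulr1 gtr0_norm. Qed.

Lemma letter_at_lt u k : (k < size u)%N -> letter_at u k = (nth 0 u k : nat)%:Z.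
Proof. by move=> ku; rewrite /= (nth_map 0). Qed.

Lemma letter_at_ge u k : (size u <= k)%N -> letter_at u k = -1.
Proof. by move=> ku; rewrite /= nth_default // size_map. Qed.

Definition Emod (e : expr) (d : int) : expr :=
  Arith Defs.Sub e (Arith Mul (Cst d) (Arith FloorDiv e (Cst d))).

(* Register 2 holds p and register 3 holds c for the current alcove (p, c). *)
Definition move_prog (e : expr) : prog :=
  Seq (Assign 4 (Emod (Arith Add (Reg 3) e) 3))
 (If (TEq (Reg 4) (Cst 1)) (Assign 3 (Arith Add (Reg 3) (Cst 1)))
 (If (TEq (Reg 4) (Cst 2)) (Assign 3 (Arith Defs.Sub (Reg 3) (Cst 1)))
   (Assign 2 (Arith Defs.Sub (Arith Add (Reg 2) (Cst 1))
     (Arith Mul (Cst 2) (Emod (Arith Defs.Sub (Reg 3) (Reg 2)) 2)))))).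

Lemma run_move_prog x y e (i : 'Z_3) st (st' := run x y (move_prog e) st) :
  eval_expr x y st e = i%:Z ->
  (st' 2%N, st' 3%N) = move i (st 2%N, st 3%N) /\
  (forall r, r \notin [:: 2; 3; 4]%N -> st' r = st r).
Proof.
move=> ei; rewrite {}/st' /move_prog /=; rewrite /set_reg /= ei /=.
have divK (a d : int) : a - d * (a %/ d)%Z = (a %% d)%Z.
  by rewrite {1}(divz_eq a d); lia.
rewrite !floor_div_pos // !divK /move /=.
do 2?[case: ifP => _ /=].
all: split=> // r; rewrite !inE !negb_or.
all: by case/and3P=> /negbTE n2 /negbTE n3 /negbTE n4; rewrite ?n2 ?n3 ?n4.
Qed.

(** The loop is driven by [y], which keeps it linear in [size y] however long [x] is, and it leaves
    [size y] in register 1. *)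
Definition read_loop : prog :=
  While (TNot (TEq (Letter InY (Reg 1)) (Cst (-1))))
 (Seq (If (TEq (Letter InX (Reg 1)) (Cst (-1))) Skip
          (move_prog (Letter InX (Reg 1))))
   (Assign 1 (Arith Add (Reg 1) (Cst 1)))).

Lemma run_read_loop x y st k : st 1%N = k%:Z -> (k <= size y)%N ->
  exists st', [/\
    runs_within x y read_loop st st' ((size y - k).+1 * max_cost read_loop),
    st' 0%N = st 0%N, st' 1%N = size y &
    (st' 2%N, st' 3%N) =
      walk (st 2%N, st 3%N) (take (size y - k) (drop k x))].
Proof.
move e: (size y - k)%N => n; elim: n k st e => [|n IHn] k st e st1 ky.
  exists st; split=> //; last by rewrite take0.
    rewrite mul1n; apply: runs_within_while_end.
    by rewrite /= st1 -/(letter_at y k) letter_at_ge //; lia.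
  by rewrite st1; lia.
have ky' : (k < size y)%N by lia.
have guard : eval_test x y st (TNot (TEq (Letter InY (Reg 1)) (Cst (-1)))).
  by rewrite /= st1 -/(letter_at y k) letter_at_lt.
pose st2 := run x y (If (TEq (Letter InX (Reg 1)) (Cst (-1))) Skip
  (move_prog (Letter InX (Reg 1)))) st.
have [st20 st21 st223] : [/\ st2 0%N = st 0%N, st2 1%N = st 1%N &
    (st2 2%N, st2 3%N) = walk (st 2%N, st 3%N) (take 1 (drop k x))].
  have {st2}-> : st2 = if eval_expr x y st (Letter InX (Reg 1)) == - 1
    then st else run x y (move_prog (Letter InX (Reg 1))) st by [].
  have [kx|xk] := ltnP k (size x); last first.
    by rewrite /= st1 -/(letter_at x k) letter_at_ge // drop_oversize.
  have ek : eval_expr x y st (Letter InX (Reg 1)) = (nth 0 x k : nat)%:Z.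
    by rewrite /= st1 -/(letter_at x k) letter_at_lt.
  have [e23 er] := run_move_prog ek.
  rewrite ek (_ : (_ == _) = false) // (er 0%N) // (er 1%N) // e23.
  by rewrite (drop_nth 0 kx) /= take0.
have [|||st' [r' st0' st1' st23']] := IHn k.+1 (set_reg st2 1%N (st2 1%N + 1)).
- by lia.
- by rewrite /set_reg /= st21 st1; lia.
- by [].
exists st'; split=> //; last first.
- rewrite st23' /set_reg /= st223 /walk -foldl_cat; congr foldl.
  by rewrite -[n.+1]add1n takeD drop_drop add1n.
- by rewrite st0' /set_reg /= st20.
have := runs_within_while guard _ r'.
by rewrite mulSn; apply.
Qed.

Definition Esq (e : expr) : expr := Arith Mul e e.

(* The squares avoid absolute values: a move changes a single height, by one,
   so it decreases this sum exactly when it decreases the length. *)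
Definition Esize (p c : expr) : expr :=
  Arith Add (Esq p) (Arith Add
    (Esq (Arith FloorDiv (Arith Add (Arith Defs.Sub c p) (Cst 1)) (Cst 2)))
    (Esq (Arith FloorDiv (Arith Add c p) (Cst 2)))).

Definition height_sq (a : point) : int :=
  height 0 a * height 0 a + (height 1 a * height 1 a + height 2 a * height 2 a).

Lemma eval_Esize x y st r1 r2 :
  eval_expr x y st (Esize (Reg r1) (Reg r2)) = height_sq (st r1, st r2).
Proof. by rewrite /= !floor_div_pos. Qed.

Lemma plen_move_sq i a :
  (plen (move i a) < plen a)%N = (height_sq (move i a) < height_sq a).
Proof.
case: a => p c; rewrite /plen /height_sq /height /=.
case: (moveP i p c) => /= *.
- have [e|e] : ((c - p) %% 2)%Z = 0 \/ ((c - p) %% 2)%Z = 1 by lia.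
  + have -> : ((c + 1 - p + 1) %/ 2)%Z = ((c - p + 1) %/ 2)%Z + 1 by lia.
    have -> : ((c + 1 + p) %/ 2)%Z = ((c + p) %/ 2)%Z by lia.
    by nia.
  + have -> : ((c + 1 - p + 1) %/ 2)%Z = ((c - p + 1) %/ 2)%Z by lia.
    have -> : ((c + 1 + p) %/ 2)%Z = ((c + p) %/ 2)%Z + 1 by lia.
    by nia.
- have [e|e] : ((c - p) %% 2)%Z = 0 \/ ((c - p) %% 2)%Z = 1 by lia.
  + have -> : ((c - 1 - p + 1) %/ 2)%Z = ((c - p + 1) %/ 2)%Z by lia.
    have -> : ((c - 1 + p) %/ 2)%Z = ((c + p) %/ 2)%Z - 1 by lia.
    by nia.
  + have -> : ((c - 1 - p + 1) %/ 2)%Z = ((c - p + 1) %/ 2)%Z - 1 by lia.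
    have -> : ((c - 1 + p) %/ 2)%Z = ((c + p) %/ 2)%Z by lia.
    by nia.
- have -> : ((c - (p + 1) + 1) %/ 2)%Z = ((c - p + 1) %/ 2)%Z by lia.
  have -> : ((c + (p + 1)) %/ 2)%Z = ((c + p) %/ 2)%Z by lia.
  by nia.
- have -> : ((c - (p - 1) + 1) %/ 2)%Z = ((c - p + 1) %/ 2)%Z by lia.
  have -> : ((c + (p - 1)) %/ 2)%Z = ((c + p) %/ 2)%Z by lia.
  by nia.
Qed.

(** Registers 5 and 6 save the alcove, so that a move that does not shorten it can be undone. *)
Definition descend_loop : prog :=
  While (TLt (Cst 0) (Reg 1))
 (Seq (Seq (Assign 1 (Arith Defs.Sub (Reg 1) (Cst 1)))
      (Seq (Assign 5 (Reg 2)) (Assign 6 (Reg 3))))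
 (Seq (move_prog (Letter InY (Reg 1)))
      (If (TLt (Esize (Reg 2) (Reg 3)) (Esize (Reg 5) (Reg 6)))
         Skip (Seq (Assign 2 (Reg 5)) (Assign 3 (Reg 6)))))).

(** Splitting the second input as [u ++ v] lets the induction shrink the unread part [u] while the
    input itself stays fixed. *)
Lemma run_descend_loop x u v (st : store) : st 1%N = size u ->
  exists st', [/\
    runs_within x (u ++ v) descend_loop st st'
      ((size u).+1 * max_cost descend_loop),
    st' 0%N = st 0%N &
    (st' 2%N, st' 3%N) = descend (rev u) (st 2%N, st 3%N)].
Proof.
elim/last_ind: u v st => [|u i IHu] v st st1.
  exists st; split=> //; rewrite mul1n.
  by apply: runs_within_while_end; rewrite /= st1.
rewrite cat_rcons rev_rcons size_rcons; rewrite size_rcons in st1.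
pose y := u ++ i :: v.
pose st2 := run x y (Seq (Assign 1 (Arith Defs.Sub (Reg 1) (Cst 1)))
      (Seq (Assign 5 (Reg 2)) (Assign 6 (Reg 3)))) st.
have st21 : st2 1%N = size u by rewrite /st2 /= /set_reg /= st1; lia.
have ei : eval_expr x y st2 (Letter InY (Reg 1)) = i%:Z.
  rewrite /= -/(letter_at y (st2 1%N)) st21 -/(letter_at y (size u)).
  rewrite letter_at_lt.
    by rewrite nth_cat ltnn subnn.
  by rewrite size_cat /=; lia.
have [] := run_move_prog ei.
set st3 := run x y _ st2; have [-> ->] : st2 2%N = st 2%N /\ st2 3%N = st 3%N.
  by rewrite /st2 /= /set_reg.
have [st20 st25 st26] :
    [/\ st2 0%N = st 0%N, st2 5%N = st 2%N & st2 6%N = st 3%N].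
  by rewrite /st2 /= /set_reg.
move=> e23 er.
pose st4 := run x y (If (TLt (Esize (Reg 2) (Reg 3)) (Esize (Reg 5) (Reg 6)))
         Skip (Seq (Assign 2 (Reg 5)) (Assign 3 (Reg 6)))) st3.
have [st40 st41 st423] : [/\ st4 0%N = st 0%N, st4 1%N = size u &
    (st4 2%N, st4 3%N) = let a := (st 2%N, st 3%N) in
    if (plen (move i a) < plen a)%N then move i a else a].
  have {st4}-> : st4 = if eval_expr x y st3 (Esize (Reg 2) (Reg 3)) <
    eval_expr x y st3 (Esize (Reg 5) (Reg 6)) then st3
    else set_reg (set_reg st3 2%N (st3 5%N)) 3%N (st3 6%N) by [].
  rewrite !eval_Esize e23 (er 5%N) // (er 6%N) // st25 st26 -plen_move_sq.
  have [st30 st31] : st3 0%N = st 0%N /\ st3 1%N = size u.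
    by rewrite (er 0%N) // (er 1%N).
  by case: ifP => lt; rewrite /set_reg /= ?lt.
have [st' [r' st0' st23']] := IHu (i :: v) st4 st41.
exists st'; split; last 2 first.
- by rewrite st0' st40.
- by rewrite st23' st423.
by rewrite mulSn; apply: runs_within_while r' => //; rewrite /= st1.
Qed.

(** After reading, an end marker of [x] at position [size y] means [size x <= size y], so [x] was
    read entirely. Otherwise a reduced [x] is too long to lie below [y], and register 0 keeps its
    initial 0. *)
Definition bruhat_prog : prog :=
  Seq read_loop
 (If (TEq (Letter InX (Reg 1)) (Cst (-1)))
   (Seq descend_loop
     (If (TAnd (TEq (Reg 2) (Cst 0)) (TEq (Reg 3) (Cst 0)))
        (Assign 0 (Cst 1)) Skip))
   Skip).

Lemma bruhat_prog_correct x y : reduced x -> reduced y ->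
  decides_within bruhat_prog x y (bruhat_le (wprod x) (wprod y))
    (max_cost bruhat_prog * (size y).+1).
Proof.
move=> rx ry.
have [|st1 [[t1 e1 l1] st10 st11 st123]] :=
  @run_read_loop x y (fun=> 0) 0 (erefl _); first by [].
rewrite subn0 drop0 in l1 st123.
have guard : eval_test x y st1 (TEq (Letter InX (Reg 1)) (Cst (-1)))
    = (size x <= size y)%N.
  rewrite [LHS]/(letter_at x (st1 1%N) == -1) st11.
  case: leqP => xy; first by rewrite letter_at_ge.
  by rewrite letter_at_lt.
have [xy|yx] := leqP (size x) (size y); last first.
  exists st1; eexists; split.
  - apply: exec_seq e1 _; apply: exec_if_false; first by rewrite guard -ltnNge.
    exact: exec_skip.
  - by move: l1; rewrite /bruhat_prog; cbn [max_cost]; nia.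
  by right; split=> // /bruhat_le_len; rewrite -rx -ry; lia.
have := @run_descend_loop x y [::] st1; rewrite cats0 => /(_ st11).
case=> st2 [[t2 e2 l2] st20 st223].
rewrite st123 take_oversize // -point_of_wprod in st223.
pose p3 := If (TAnd (TEq (Reg 2) (Cst 0)) (TEq (Reg 3) (Cst 0)))
        (Assign 0 (Cst 1)) Skip.
have [t3 e3 l3] := @run_loop_free x y p3 st2 isT.
exists (run x y p3 st2); eexists; split.
- apply: exec_seq e1 _; apply: exec_if_true; first by rewrite guard.
  exact: exec_seq e2 e3.
- by move: l1 l2 l3; rewrite /p3 /bruhat_prog; cbn [max_cost]; nia.
rewrite (bruhat_leP _ ry) folds_descend -st223 /=.
case: ifP => [/andP[/eqP-> /eqP->]|/negbT]; first by left.
rewrite negb_and => ne; right; split; last by rewrite st20.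
by case=> e2' e3'; move: ne; rewrite e2' e3'.
Qed.

Theorem theorem1p2 :
  (forall n m i j : int, 2 <= n -> 0 <= m -> (2 %| i)%Z ->
     let k := kfun n m (divz (i + 2 * j) 2) in
     shadow (alcove n m) (alcove i j) <-> (2 - k <= i /\ i <= k))
  /\
  (exists (p : prog) (C : nat), forall x y : word,
     reduced x -> reduced y ->
     decides_within p x y (bruhat_le (wprod x) (wprod y)) (C * (size y).+1)).
Proof.
split; last first.
  exists bruhat_prog, (max_cost bruhat_prog) => x y.
  exact: bruhat_prog_correct.
case=> [n|//] [m|//] i j n2 _ i2 k.
have -> : alcove i j = alcove_at ((i %/ 2)%Z, (i %/ 2)%Z + j).
  by rewrite /alcove_at; congr alcove => /=; lia.
rewrite shadow_alcove // alcove_atK /in_kfun /=.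
rewrite (_ : (i %/ 2)%Z + j = ((i + 2 * j) %/ 2)%Z).
  by rewrite -/k (_ : 2 * (i %/ 2)%Z = i); last by lia.
by lia.
Qed.
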